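(* Let $k>1$. It is impossible for $k+1$ agents to successfully locate the black hole in dynamic cactus graphs with at most $k$ dynamic edges at any round: no algorithm with $k+1$ agents solves the black hole search problem on all such graphs. This holds regardless of whether the agents know $n$ and $k$, and regardless of the presence of a whiteboard at each node.
   Context: Cactus graph: a connected undirected graph in which any two distinct simple cycles share at most one vertex (equivalently, every edge lies on at most one simple cycle). Dynamic cactus graph with at most $k$ dynamic edges at any round: a fixed cactus (the footprint, $G_0$) on a static vertex set $V$ with $|V|=n$, together with a sequence of graphs $G_0,G_1,G_2,\dots$, $G_r=(V,E_r)$, where $G_r$ is the footprint with at most $k$ edges missing, and each $G_r$ is connected ($1$-interval connectivity). At each round an adversary chooses which edges are missing; missing edges may reappear later. The degree $\deg(v)$ is the degree in $G_0$; $\Delta$ is the maximum degree. Nodes are anonymous. At each node $v$ the incident edges carry distinct port numbers $0,\dots,\deg(v)-1$ (in counter-clockwise order); the two port numbers of an edge are unrelated. Each node $v$ has a whiteboard of $O(\deg(v)(\log\deg(v)+k\log k))$ bits, readable and writable by visiting agents under fair mutual exclusion. Black hole: one node of the graph is a black hole; every agent entering it is destroyed without a trace. Agents: a set of $m\le n$ agents with distinct Ids in $[1,m]$, initially co-located at a node called home that is known not to be the black hole. All agents execute the same deterministic algorithm; each has $O(n\log\Delta)$ bits of memory. An agent at a node sees the degree, which incident edges are currently missing, the whiteboard, and the Ids of the other agents there, and can communicate with these agents. When moving along an edge it knows the port by which it leaves and the port by which it arrives. Any number of agents may use an edge simultaneously. Rounds: in every synchronous round each agent communicates (with co-located agents and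 via the whiteboard), computes a decision to stay or to leave through a port, and then moves (traversing a present edge takes one round). Black hole search problem (BHS): within finitely many rounds, at least one agent must survive, know the location of the black hole, and terminate, whatever the footprint, its port numbering, the location of the black hole, and the adversary's choice of missing edges. *)

(* Defs.v *)
From mathcomp Require Import all_boot.

Set Implicit Arguments.
Unset Strict Implicit.
Unset Printing Implicit Defensive.

Section Footprint.
Variable V : finType.

(* For adjacent u and v, [port G v u] is the number carried at v by the edge
   between v and u; values of [port] on non-adjacent pairs are irrelevant. *)
Record port_graph := PortGraph { adj : rel V; port : V -> V -> nat }.

Definition simple_cycle (e : rel V) (c : seq V) : bool :=
  [&& 2 < size c, cycle e c & uniq c].

(* A cycle is given by a listing of its vertices; two listings describe the
   same cycle when they have the same edges. *)
Definition cycle_edges (c : seq V) : {set {set V}} :=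
  [set [set x; next c x] | x in c].

Definition connected (e : rel V) : Prop := forall u v, connect e u v.

Definition cactus (e : rel V) : Prop :=
  connected e /\
  forall c c' : seq V, simple_cycle e c -> simple_cycle e c' ->
    cycle_edges c <> cycle_edges c' ->
    #|[set x in c] :&: [set x in c']| <= 1.

Variable G : port_graph.

Definition deg (v : V) : nat := #|[set u | adj G v u]|.
Definition max_deg : nat := \max_(v : V) deg v.

Definition edges : {set {set V}} :=
  [set e | [exists u, [exists v, adj G u v && (e == [set u; v])]]].

Definition port_numbering : Prop :=
  forall v, (forall u, adj G v u -> port G v u < deg v) /\
            {in adj G v &, injective (port G v)}.

Definition between (a b x : nat) : bool := minn a b < x < maxn a b.

(* The ports around each vertex follow the counter-clockwise order of a drawing
   of the cactus in the plane, numbering starting at an arbitrary edge.  A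
   family of cyclic orders around the vertices of a cactus comes from a plane
   drawing iff no two cycles cross at a common vertex, i.e. the two ports of
   one cycle do not separate the two ports of the other. *)
Definition ccw_ports : Prop :=
  forall (v : V) (c c' : seq V),
    simple_cycle (adj G) c -> simple_cycle (adj G) c' ->
    cycle_edges c <> cycle_edges c' -> v \in c -> v \in c' ->
    let separated u := between (port G v (next c v)) (port G v (prev c v))
                               (port G v u) in
    separated (next c' v) = separated (prev c' v).

Definition cactus_footprint : Prop :=
  [/\ symmetric (adj G), irreflexive (adj G), cactus (adj G),
      port_numbering & ccw_ports].

(* [present M] is the footprint without the edges in M. *)
Definition present (M : {set {set V}}) : rel V :=
  [rel u v | adj G u v && ([set u; v] \notin M)].

Definition missing_ports (M : {set {set V}}) (v : V) : seq nat :=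
  [seq p <- iota 0 (deg v) |
     [exists u, [&& adj G v u, [set v; u] \in M & port G v u == p]]].

(* [missing r] is the set of footprint edges absent from the r-th graph; the
   graph of index 0 is the footprint itself. *)
Definition dynamic_with_at_most (k : nat) (missing : nat -> {set {set V}}) :
    Prop :=
  missing 0 = set0 /\
  forall r, [/\ missing r \subset edges, #|missing r| <= k
              & connected (present (missing r))].

(* The end of an edge of e leaving v through port p, if there is one. *)
Definition follow (e : rel V) (v : V) (p : nat) : option V :=
  [pick u | e v u && (port G v u == p)].

Fixpoint follow_route (v : V) (q : seq nat) : option V :=
  if q is p :: q' then
    if follow (adj G) v p is Some u then follow_route u q' else None
  else Some v.

End Footprint.

Section Algorithms.

Definition bits := seq bool.

(* A location is reported as a route: the ports to take, in the footprint,
   from the node where the reporting agent stands. *)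
Definition route := seq nat.

(* What an agent has at hand when it computes.  The arrival port is that of its
   last move ([None] before any move).  Communication between co-located agents
   is unrestricted: each one gets the Id, arrival port and memory of the
   others.  [sees_n] and [sees_k] are [None] when the parameter is unknown. *)
Record local_view := LocalView {
  own_id : nat;
  own_memory : bits;
  own_arrival : option nat;
  sees_degree : nat;
  sees_missing : seq nat;
  sees_whiteboard : bits;
  sees_others : seq (nat * option nat * bits);
  sees_n : option nat;
  sees_k : option nat }.

(* An agent may terminate with or without reporting the black hole. *)
Inductive decision :=
  | Stay
  | Leave of nat
  | Terminate of option route.

Record action := Action {
  new_memory : bits;
  new_whiteboard : bits;
  decided : decision }.

Definition algorithm := local_view -> action.

End Algorithms.

Record scenario (V : finType) := Scenario {
  graph : port_graph V;
  missing : nat -> {set {set V}};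
  home : V;
  black_hole : V }.

Definition admissible (k m : nat) (V : finType) (S : scenario V) : Prop :=
  [/\ cactus_footprint (graph S), dynamic_with_at_most (graph S) k (missing S),
      m <= #|V| & home S <> black_hole S].

(* [report] is [None] until the agent terminates. *)
Record agent_state (V : finType) := AgentState {
  location : V;
  arrival : option nat;
  memory : bits;
  report : option (option route) }.

Record configuration (V : finType) (m : nat) := Configuration {
  agent : 'I_m -> agent_state V;
  whiteboard : V -> bits }.

Record knowledge := Knowledge {
  knows_n : bool;
  knows_k : bool;
  has_whiteboards : bool }.

Section Execution.
Variables (V : finType) (k m : nat) (K : knowledge).
Variables (A : algorithm) (S : scenario V).

Notation G := (graph S).

(* Home is not the black hole, so an agent is located at the black hole exactly
   when it has entered it; from then on it neither acts nor is seen. *)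
Definition destroyed (a : agent_state V) : bool := location a == black_hole S.

Definition active (a : agent_state V) : bool :=
  ~~ destroyed a && ~~ isSome (report a).

(* The Ids are 1, ..., m. *)
Definition agent_id (i : 'I_m) : nat := i.+1.

Definition initial : configuration V m :=
  Configuration (fun=> AgentState (home S) None [::] None) (fun=> [::]).

Definition view_of (C : configuration V m) (M : {set {set V}}) (i : 'I_m)
    (w : bits) : local_view :=
  let a := agent C i in
  {| own_id := agent_id i;
     own_memory := memory a;
     own_arrival := arrival a;
     sees_degree := deg G (location a);
     sees_missing := missing_ports G M (location a);
     sees_whiteboard := w;
     sees_others :=
       [seq (agent_id j, arrival (agent C j), memory (agent C j))
          | j <- enum 'I_m
          & (j != i) && (location (agent C j) == location a)];
     sees_n := if knows_n K then Some #|V| else None;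
     sees_k := if knows_k K then Some k else None |}.

(* Mutual exclusion: in each round the agents at a node access its whiteboard
   once each, in increasing order of Ids.  Without whiteboards nothing is ever
   written. *)
Fixpoint write_boards (C : configuration V m) (M : {set {set V}})
    (s : seq 'I_m) (b : V -> bits) : V -> bits :=
  if s is i :: s' then
    let v := location (agent C i) in
    let b' := if has_whiteboards K && active (agent C i) then
                fun u => if u == v
                         then new_whiteboard (A (view_of C M i (b v)))
                         else b u
              else b in
    write_boards C M s' b'
  else b.

Definition board_at_turn (C : configuration V m) (M : {set {set V}})
    (i : 'I_m) : bits :=
  write_boards C M (take i (enum 'I_m)) (whiteboard C) (location (agent C i)).

(* Leaving through a missing edge or a non-existent port has no effect. *)
Definition next_agent (C : configuration V m) (M : {set {set V}})
    (i : 'I_m) : agent_state V :=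
  let a := agent C i in
  if ~~ active a then a else
  let x := A (view_of C M i (board_at_turn C M i)) in
  let stay := AgentState (location a) (arrival a) (new_memory x) None in
  match decided x with
  | Stay => stay
  | Leave p =>
      if follow G (present G M) (location a) p is Some u
      then AgentState u (Some (port G u (location a))) (new_memory x) None
      else stay
  | Terminate q => AgentState (location a) (arrival a) (new_memory x) (Some q)
  end.

Definition round (M : {set {set V}}) (C : configuration V m) :
    configuration V m :=
  Configuration (next_agent C M) (write_boards C M (enum 'I_m) (whiteboard C)).

(* The configuration at the beginning of round r. *)
Fixpoint run (r : nat) : configuration V m :=
  if r is r'.+1 then round (missing S r') (run r') else initial.

Definition terminates_reporting (a : agent_state V) (q : route) : Prop :=
  ~~ destroyed a /\ report a = Some (Some q).

Definition correct_route (a : agent_state V) (q : route) : Prop :=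
  follow_route G (location a) q = Some (black_hole S).

Definition space_used_at_most (c : nat) : Prop :=
  forall r,
    (forall i : 'I_m, ~~ destroyed (agent (run r) i) ->
       size (memory (agent (run r) i))
         <= c * (#|V| * up_log 2 (max_deg G))) /\
    (forall v : V,
       size (whiteboard (run r) v)
         <= c * (deg G v * (up_log 2 (deg G v) + k * up_log 2 k))).

End Execution.

Definition space_bounded (k m : nat) (K : knowledge) (A : algorithm) : Prop :=
  exists c, forall (V : finType) (S : scenario V),
    admissible k m S -> space_used_at_most k m K A S c.

(* In every admissible scenario some agent survives, terminates and reports the
   black hole.  Since a reporting agent must know the location, as opposed to
   guessing it, no report is ever wrong: were a report right in one scenario
   and wrong in another that the agent cannot tell apart, it would not be
   knowledge. *)
Definition solves_BHS (k m : nat) (K : knowledge) (A : algorithm) : Prop :=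
  forall (V : finType) (S : scenario V), admissible k m S ->
    (exists r (i : 'I_m) q,
       terminates_reporting S (agent (run k m K A S r) i) q /\
       correct_route S (agent (run k m K A S r) i) q) /\
    (forall r (i : 'I_m) q,
       terminates_reporting S (agent (run k m K A S r) i) q ->
       correct_route S (agent (run k m K A S r) i) q).

(* Main.v *)
Require Import Defs.
From Stdlib Require Import FunctionalExtensionality.
From mathcomp Require Import all_boot zify.

(** Let k = n + 1.  The footprint is a chain of k 4-cycles, any two consecutive
    ones sharing a vertex, and home is its first vertex.  In each of the first n
    cycles the adversary can keep one agent from passing the far end with a single
    missing edge, so at most two of the k + 1 agents, counting the dead, are ever
    in the last cycle h, x, z, y.  There one missing edge defeats them.  If nobody
    leaves h, nothing is learnt.  If both agents at h leave it for x when hy is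
    missing and for y when hx is missing, they die with the black hole there, and
    the other agents cannot tell x from y.  Otherwise a single agent enters, say,
    x, and from then on hx is missing: that agent cannot rule out that the black
    hole is y, and the other agents cannot rule out that it is x, so when it
    is z nobody can report it. *)

Set Implicit Arguments.
Unset Strict Implicit.
Unset Printing Implicit Defensive.

(** * Neighbours of a vertex along a simple cycle *)

Section Cycles.
Variables (V : finType) (e : rel V).

(** On a duplicate-free list the iterates of [next c] from any entry run through all entries. *)
Lemma next_closed_sub (c : seq V) (P : pred V) x :
  uniq c -> x \in c -> P x -> (forall y, y \in c -> P y -> P (next c y)) ->
  {in c, forall y, P y}.
Proof.
move=> uc xc Px clP y yc.
have := fconnect_cycle (cycle_next uc) xc y; rewrite yc => /iter_findex <-.
elim: (findex _ _ _) => //= j IH; apply: (clP _ _ IH).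
by elim: j {IH} => //= j IH; rewrite mem_next.
Qed.

Lemma next_neq_prev (c : seq V) x :
  simple_cycle e c -> x \in c -> next c x != prev c x.
Proof.
case/and3P=> sz _ uc /rot_to[i s def_s].
have us : uniq (x :: s) by rewrite -def_s rot_uniq.
rewrite -(next_rot i uc) -(prev_rot i uc) def_s.
have: 2 < size (x :: s) by rewrite -def_s size_rot.
move=> sz'; rewrite next_nth prev_nth mem_head /= eqxx.
case/andP: us => xs us; rewrite (memNindex xs) nth_last /=.
case: s {def_s} sz' us xs => [//|y [//|w s]] _ /= /andP[ys _] _.
by apply: contraNneq ys => ->; rewrite mem_last.
Qed.

Lemma cycle_neighbours (c : seq V) x : symmetric e ->
  simple_cycle e c -> x \in c ->
  [/\ next c x \in c, prev c x \in c, e x (next c x), e x (prev c x)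
    & next c x != prev c x].
Proof.
move=> sym cc xc; have [_ ec _] := and3P cc.
rewrite mem_next mem_prev xc next_neq_prev // (next_cycle ec) //.
by rewrite sym (prev_cycle ec).
Qed.
End Cycles.

(** * The footprint: a chain of 4-cycles *)

(** The [i]-th cycle, [i <= n], is 3i, 3i + 1, 3i + 3, 3i + 2 in this order, so
    consecutive cycles share a multiple of 3. *)
Section Chain.
Variable n : nat.

Definition node := 'I_(3 * n).+4.

Definition chain_adj : rel node :=
  fun u v => ((3 %| u) != (3 %| v)) && (u - v <= 2) && (v - u <= 2).

(** Ranking the neighbours keeps the two ports of one cycle below those of the
    other at every cut vertex. *)
Definition chain_port (v u : node) : nat :=
  #|[set w | chain_adj v w && (w < u)]|.

Definition chain := PortGraph chain_adj chain_port.

Lemma chain_adj_sym : symmetric chain_adj.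
Proof. by move=> u v; rewrite /chain_adj; lia. Qed.

Lemma chain_adj_irr : irreflexive chain_adj.
Proof. by move=> u; rewrite /chain_adj; lia. Qed.

Lemma chain_port_lt (v u w : node) :
  chain_adj v u -> u < w -> chain_port v u < chain_port v w.
Proof.
move=> vu uw; apply: proper_card; apply/properP; split.
  by apply/subsetP=> a; rewrite !inE => /andP[-> au]; rewrite (ltn_trans au).
by exists u; rewrite !inE ?vu ?uw // ltnn andbF.
Qed.

Lemma chain_port_numbering : port_numbering chain.
Proof.
move=> v; split=> [u vu|u w vu vw eqp].
  apply: proper_card; apply/properP; split.
    by apply/subsetP=> a; rewrite !inE => /andP[].
  by exists u; rewrite !inE ?vu // ltnn andbF.
rewrite /in_mem /= in vu vw.
case: (ltngtP u w) => [uw|wu|/val_inj //].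
  by have := chain_port_lt vu uw; rewrite [chain_port v u]eqp ltnn.
by have := chain_port_lt vw wu; rewrite [chain_port v u]eqp ltnn.
Qed.


(** * The simple cycles of the chain *)

Lemma chain_adj_hub i (u v : node) : u = 3 * i :> nat -> chain_adj u v ->
  [\/ v = 3 * i + 1 :> nat, v = 3 * i + 2 :> nat, v + 1 = 3 * i | v + 2 = 3 * i].
Proof.
move=> eu; rewrite /chain_adj eu => uv.
have [?|n1] := boolP (v == 3 * i + 1 :> nat); first by apply: Or41; lia.
have [?|n2] := boolP (v == 3 * i + 2 :> nat); first by apply: Or42; lia.
have [?|n3] := boolP (v + 1 == 3 * i :> nat); first by apply: Or43; lia.
by apply: Or44; lia.
Qed.

Lemma chain_adj_side i (u v : node) : u = 3 * i + 1 :> nat \/ u = 3 * i + 2 :> nat ->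
  chain_adj u v -> v = 3 * i :> nat \/ v = 3 * i + 3 :> nat.
Proof.
move=> eu; rewrite /chain_adj => uv.
have [?|n1] := boolP (v == 3 * i :> nat); [left|right]; lia.
Qed.

(** The least vertex of a cycle has two larger neighbours, so it is some 3i, and these are 3i + 1
    and 3i + 2. Both have 3i + 3 as their only other neighbour, so the cycle closes there. *)
Lemma chain_cycle (c : seq node) : simple_cycle chain_adj c ->
  exists2 i, i <= n & forall v : node, (v \in c) = (3 * i <= v <= 3 * i + 3).
Proof.
move=> cc; have nb := cycle_neighbours chain_adj_sym cc.
have [sz _ uc] := and3P cc; move: cc sz => _ sz.
have [v0 v0c] : exists v, v \in c by case: (c) sz => // v s _; exists v; rewrite mem_head.
case: (arg_minnP (fun v : node => v : nat) v0c) => m mc m_min {v0 v0c sz}.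
have two (y : node) : y \in c -> exists a b : node,
    [/\ a \in c, b \in c, chain_adj y a, chain_adj y b & a <> b :> nat].
  move=> yc; have [ny py ay by_ ne] := nb y yc.
  by exists (next c y), (prev c y); split=> // /val_inj/eqP; apply/negP.
(* A vertex not divisible by 3 has degree at most 2, so the cycle uses all its edges. *)
have around (y w : node) : y \in c -> w \in c -> chain_adj y w -> ~~ (3 %| y) ->
    next c w = y \/ prev c w = y.
  move=> yc wc yw y3; have [_ _ a1 b1 ne1] := nb y yc.
  have ey : y = 3 * (y %/ 3) + 1 :> nat \/ y = 3 * (y %/ 3) + 2 :> nat.
    by move: y3; clear; lia.
  have [enx|nnx] := eqVneq (next c y) w; first by right; rewrite -enx prev_next.
  left; have -> : w = prev c y; last by rewrite next_prev.
  apply: val_inj; move: nnx ne1; rewrite -!(inj_eq val_inj) /=.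
  have := chain_adj_side ey a1; have := chain_adj_side ey b1.
  have := chain_adj_side ey yw.
  move: (nat_of_ord (next c y)) (nat_of_ord (prev c y)) (nat_of_ord w).
  by clear; lia.
pose i := m %/ 3; have em : m = 3 * i :> nat.
  have [a [b [ac bc ma mb neab]]] := two m mc.
  have lea := m_min a ac; have leb := m_min b bc.
  have [|] := boolP (3 %| m); first by rewrite /i; clear; lia.
  move=> m3; have em : m = 3 * i + 1 :> nat \/ m = 3 * i + 2 :> nat.
    by rewrite /i; move: m3; clear; lia.
  have := chain_adj_side em ma; have := chain_adj_side em mb.
  by move: lea leb neab em; clear; lia.
have [[y1 y1c ey1] [y2 y2c ey2]] :
    (exists2 y : node, y \in c & y = 3 * i + 1 :> nat) /\
    (exists2 y : node, y \in c & y = 3 * i + 2 :> nat).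
  have [a [b [ac bc ma mb neab]]] := two m mc.
  have lea := m_min a ac; have leb := m_min b bc.
  rewrite em in lea leb.
  have [ea|ea|ea|ea] := chain_adj_hub em ma; have [eb|eb|eb|eb] := chain_adj_hub em mb.
  all: try by move: lea leb neab ea eb; clear; lia.
  - by split; [exists a|exists b].
  - by split; [exists b|exists a].
have [z zc ez] : exists2 z : node, z \in c & z = 3 * i + 3 :> nat.
  have [a [b [ac bc ma mb neab]]] := two y1 y1c.
  have [] := chain_adj_side (or_introl ey1) ma => ea; last by exists a.
  have [] := chain_adj_side (or_introl ey1) mb => eb; last by exists b.
  by case: neab; rewrite ea eb.
(* Both [y1] and [y2] are beside [z] on the cycle and cannot both precede it, so the cycle turns
   back at [z]. *)
have z_next : next c z = y1 \/ next c z = y2.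
  have zy (y : node) : y = 3 * i + 1 :> nat \/ y = 3 * i + 2 :> nat -> chain_adj y z.
    by rewrite /chain_adj ez; clear; lia.
  have y1_3 : ~~ (3 %| y1) by rewrite ey1; clear; lia.
  have y2_3 : ~~ (3 %| y2) by rewrite ey2; clear; lia.
  have [->|e1] := around y1 z y1c zc (zy _ (or_introl ey1)) y1_3; first by left.
  have [->|e2] := around y2 z y2c zc (zy _ (or_intror ey2)) y2_3; first by right.
  by move: ey2; rewrite -e2 e1 ey1; clear; lia.
have bound : {in c, forall v : node, v <= 3 * i + 3}.
  apply: (next_closed_sub (P := fun v : node => v <= 3 * i + 3)) uc mc _ _; first lia.
  move=> y yc ley; have [ny _ ay _ _] := nb y yc.
  have ge_y := m_min y yc.
  have [yz|nyz] := eqVneq y z.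
    by case: z_next; rewrite yz => ->; rewrite ?ey1 ?ey2; clear; lia.
  have [ym|nym] := eqVneq y m.
    rewrite ym in ay *; move: (chain_adj_hub em ay).
    by move: (nat_of_ord (next c m)) => a; clear; case; lia.
  have eys : y = 3 * i + 1 :> nat \/ y = 3 * i + 2 :> nat.
    move: nyz nym ge_y ley; rewrite -!(inj_eq val_inj) /= em ez.
    by move: (nat_of_ord y); clear; lia.
  have := chain_adj_side eys ay.
  by move: (nat_of_ord (next c y)); clear; lia.
exists i; first by have := ltn_ord z; lia.
move=> v; apply/idP/idP => [vc|v_in].
  by rewrite bound // andbT -em m_min.
have : [|| v == m :> nat, v == y1 :> nat, v == y2 :> nat | v == z :> nat].
  by rewrite em ey1 ey2 ez; move: v_in; move: (nat_of_ord v); clear; lia.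
by case/or4P=> /eqP/val_inj->.
Qed.

(** Inside a block each vertex has just two neighbours, which must be its successor and predecessor
    on [c]. The edge set thus depends on [i] alone, so cycles with different edges lie in different
    blocks. *)
Lemma chain_cycle_edges (c : seq node) i : simple_cycle chain_adj c ->
    (forall v : node, (v \in c) = (3 * i <= v <= 3 * i + 3)) ->
  cycle_edges c = [set d | [exists u : node, exists v : node,
    [&& chain_adj u v, d == [set u; v], 3 * i <= u <= 3 * i + 3
      & 3 * i <= v <= 3 * i + 3]]].
Proof.
move=> cc c_i; have nb := cycle_neighbours chain_adj_sym cc.
have [_ _ uc] := and3P cc.
apply/setP=> d; apply/imsetP/idP => [[u uc' ->]|].
  rewrite inE; apply/existsP; exists u; apply/existsP; exists (next c u).
  by have [nu _ au _ _] := nb u uc'; rewrite au eqxx -!c_i uc' nu.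
rewrite inE => /existsP[u /existsP[v /and4P[uv /eqP-> u_i v_i]]].
have uc' : u \in c by rewrite c_i.
have [nu pu au bu ne] := nb u uc'.
have [env|nnv] := eqVneq (next c u) v; first by exists u; rewrite // env.
suff epv : prev c u = v by exists v; rewrite ?c_i // -epv next_prev // setUC.
apply: val_inj => /=; move: nu pu nnv ne; rewrite !c_i -!(inj_eq val_inj) /=.
have : [\/ u = 3 * i :> nat, u = 3 * i.+1 :> nat |
           u = 3 * i + 1 :> nat \/ u = 3 * i + 2 :> nat].
  have [?|n1] := eqVneq (u : nat) (3 * i); first by apply: Or31.
  have [?|n2] := eqVneq (u : nat) (3 * i.+1); first by apply: Or32.
  by apply: Or33; move: u_i n1 n2; clear; lia.
case=> eu; [have N := chain_adj_hub eu|have N := chain_adj_hub eu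
           |have N := chain_adj_side eu].
all: move: (N _ uv) (N _ au) (N _ bu) v_i; clear.
all: move: (nat_of_ord v) (nat_of_ord (next c u)) (nat_of_ord (prev c u)) => v' a b.
- by move=> [?|?|?|?] [?|?|?|?] [?|?|?|?]; lia.
- by move=> [?|?|?|?] [?|?|?|?] [?|?|?|?]; lia.
- by lia.
Qed.

Lemma chain_cycles_apart (c c' : seq node) :
    simple_cycle chain_adj c -> simple_cycle chain_adj c' ->
    cycle_edges c <> cycle_edges c' ->
  exists i j, [/\ i != j,
    forall v : node, (v \in c) = (3 * i <= v <= 3 * i + 3) &
    forall v : node, (v \in c') = (3 * j <= v <= 3 * j + 3)].
Proof.
move=> cc cc' ne; have [i _ ci] := chain_cycle cc.
have [j _ cj] := chain_cycle cc'; exists i, j; split=> //.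
apply/eqP=> eij; apply: ne; rewrite (chain_cycle_edges cc ci) eij.
by rewrite -(chain_cycle_edges cc' cj).
Qed.

Lemma chain_ccw_ports : ccw_ports chain.
Proof.
move=> v c c' cc cc' ne vc vc' sep.
have [i [j [nij ci cj]]] := chain_cycles_apart cc cc' ne.
have [nu pu au bu _] := cycle_neighbours chain_adj_sym cc vc.
have [nu' pu' au' bu' _] := cycle_neighbours chain_adj_sym cc' vc'.
have neq (w : node) : chain_adj v w -> (w : nat) != v.
  by apply: contraTneq => /val_inj->; rewrite chain_adj_irr.
have same a b : a < b -> forall w : node,
    3 * a <= v <= 3 * a + 3 -> 3 * b <= v <= 3 * b + 3 -> (w : nat) != v ->
    (3 * a <= w <= 3 * a + 3 -> w < v) /\ (3 * b <= w <= 3 * b + 3 -> v < w).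
  move=> ltab w; move: (nat_of_ord v) (nat_of_ord w) => x y.
  by move: ltab; clear; lia.
have lt_or : (forall u w : node, u \in c -> chain_adj v u -> w \in c' ->
    chain_adj v w -> chain_port v u < chain_port v w) \/
  (forall u w : node, u \in c -> chain_adj v u -> w \in c' ->
    chain_adj v w -> chain_port v w < chain_port v u).
  move: vc vc' nij; rewrite ci cj neq_ltn => vi vj /orP[lt|lt]; [left|right].
    move=> u w; rewrite ci cj => ui vu wj vw; apply: chain_port_lt => //.
    have [ltu _] := same _ _ lt u vi vj (neq u vu).
    have [_ ltw] := same _ _ lt w vi vj (neq w vw).
    exact: ltn_trans (ltu ui) (ltw wj).
  move=> u w; rewrite ci cj => ui vu wj vw; apply: chain_port_lt => //.
  have [_ ltu] := same _ _ lt u vj vi (neq u vu).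
  have [ltw _] := same _ _ lt w vj vi (neq w vw).
  exact: ltn_trans (ltw wj) (ltu ui).
(* Neither port of [c'] falls between those of [c], because all ports of one cycle precede all ports
   of the other; both sides are false. *)
suff no w : w \in c' -> chain_adj v w -> sep w = false by rewrite !no.
move=> wc vw; rewrite /sep /between /=; apply/negbTE; rewrite negb_and -!leqNgt.
case: lt_or => lt; rewrite ?leq_min ?geq_max.
  by apply/orP; right; rewrite !(ltnW (lt _ _ _ _ _ _)).
by apply/orP; left; rewrite !(ltnW (lt _ _ _ _ _ _)).
Qed.

(** * The chain with one edge missing per cycle *)

(** [d] lists in increasing order the ends of an edge of the [i]-th cycle. *)
Definition in_block i (d : nat * nat) :=
  [|| d == (3 * i, 3 * i + 1), d == (3 * i, 3 * i + 2),
      d == (3 * i + 1, 3 * i + 3) | d == (3 * i + 2, 3 * i + 3)].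

Definition one_per_block (p : nat -> nat * nat) : {set {set node}} :=
  [set [set inord (p i).1; inord (p i).2] | i : 'I_n.+1].

Definition in_blocks p := forall i, i <= n -> in_block i (p i).

Lemma inord_in_block i a b : i <= n -> in_block i (a, b) ->
  (inord a : node) = a :> nat /\ (inord b : node) = b :> nat.
Proof.
rewrite /in_block !xpair_eqE => lin pi.
by rewrite !inordK //; move: pi lin; clear; lia.
Qed.

(** An edge of the i-th cycle has its smaller end among 3i, 3i + 1, 3i + 2, so [u %/ 3] recovers the
    cycle and only that value of [p] matters. *)
Lemma mem_one_per_block p (u v : node) : in_blocks p -> chain_adj u v -> u < v ->
  ([set u; v] \in one_per_block p) = (p (u %/ 3) == (u : nat, v : nat)).
Proof.
move=> hp uv ltuv; have v_lt := ltn_ord v.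
have le_u : u %/ 3 <= n by move: v_lt ltuv; clear; lia.
apply/imsetP/eqP => [[i _ euv]|ep]; last first.
  exists (Ordinal (le_u : u %/ 3 < n.+1)) => //=.
  by rewrite ep /= !inord_val.
have := hp i (ltn_ord i); case def_p: (p i) euv => [a b] /= euv pi.
have [ea eb] := inord_in_block (ltn_ord i) pi.
have : u \in [set u; v] by rewrite !inE eqxx.
have : v \in [set u; v] by rewrite !inE eqxx orbT.
rewrite euv !inE -!(inj_eq val_inj) /= ea eb => hv hu.
move: pi; rewrite /in_block !xpair_eqE => pi.
have eu : u = a :> nat by move: pi hu hv ltuv; clear; lia.
have ev : v = b :> nat by move: pi hu hv ltuv; clear; lia.
suff -> : u %/ 3 = i by rewrite def_p eu ev.
by move: pi ltuv; rewrite eu ev; move: (nat_of_ord i); clear; lia.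
Qed.

Lemma one_per_block_edges p : in_blocks p -> one_per_block p \subset edges chain.
Proof.
move=> hp; apply/subsetP=> d /imsetP[i _ ->]; rewrite inE.
apply/existsP; exists (inord (p i).1); apply/existsP; exists (inord (p i).2).
rewrite eqxx andbT /= /chain_adj.
have := hp i (ltn_ord i); case: (p i) => [a b] /= pi.
have [-> ->] := inord_in_block (ltn_ord i) pi.
move: pi; rewrite /in_block !xpair_eqE; move: (nat_of_ord i); clear; lia.
Qed.

Lemma card_one_per_block p : #|one_per_block p| <= n.+1.
Proof. by rewrite (leq_trans (leq_imset_card _ _)) // card_ord. Qed.

(** A 4-cycle without one edge is a path, so every vertex of a cycle still reaches the first vertex
    of that cycle; descending cycle by cycle ends at 0. *)
Lemma connected_one_per_block (M : {set {set node}}) p :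
  in_blocks p -> M \subset one_per_block p -> connected (present chain M).
Proof.
move=> hp sM.
have symM : symmetric (present chain M).
  move=> u v; congr (_ && _); first exact: chain_adj_sym.
  by rewrite [in LHS]setUC.
have symC : connect_sym (present chain M) by apply: sym_connect_sym.
suff from0 : forall v, connect (present chain M) ord0 v.
  by move=> u v; apply: connect_trans (from0 v); rewrite symC.
have edge (u w : node) : chain_adj u w -> u < w ->
    p (u %/ 3) != (u : nat, w : nat) -> connect (present chain M) u w.
  move=> uw ltuw npu; apply: connect1; apply/andP; split=> //.
  by apply: contra npu => /(subsetP sM); rewrite mem_one_per_block.
have node_of a : a <= 3 * n + 3 -> exists v : node, v = a :> nat.
  by move=> lea; exists (inord a); rewrite inordK //; move: lea; clear; lia.
have block i (v : node) : i <= n -> 3 * i <= v <= 3 * i + 3 ->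
    exists2 b : node, b = 3 * i :> nat & connect (present chain M) b v.
  move=> lin vi.
  have [b eb] : exists v : node, v = 3 * i :> nat by apply: node_of; lia.
  have [x ex] : exists v : node, v = 3 * i + 1 :> nat by apply: node_of; lia.
  have [y ey] : exists v : node, v = 3 * i + 2 :> nat by apply: node_of; lia.
  have [d ed] : exists v : node, v = 3 * i + 3 :> nat by apply: node_of; lia.
  exists b => //.
  have bx : p i != (3 * i, 3 * i + 1) -> connect (present chain M) b x.
    move=> np; apply: edge; rewrite /chain_adj eb ex; try by clear; lia.
    by have -> : 3 * i %/ 3 = i by clear; lia.
  have by_ : p i != (3 * i, 3 * i + 2) -> connect (present chain M) b y.
    move=> np; apply: edge; rewrite /chain_adj eb ey; try by clear; lia.
    by have -> : 3 * i %/ 3 = i by clear; lia.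
  have xd : p i != (3 * i + 1, 3 * i + 3) -> connect (present chain M) x d.
    move=> np; apply: edge; rewrite /chain_adj ed ex; try by clear; lia.
    by have -> : (3 * i + 1) %/ 3 = i by clear; lia.
  have yd : p i != (3 * i + 2, 3 * i + 3) -> connect (present chain M) y d.
    move=> np; apply: edge; rewrite /chain_adj ed ey; try by clear; lia.
    by have -> : (3 * i + 2) %/ 3 = i by clear; lia.
  have {edge} : [/\ connect (present chain M) b x, connect (present chain M) b y
                  & connect (present chain M) b d].
    have := hp i lin; rewrite /in_block.
    case/or4P=> /eqP ep; rewrite ep !xpair_eqE in bx by_ xd yd.
    - have {}by_ := by_ ltac:(by clear; lia); have {}yd := yd ltac:(by clear; lia).
      have {}xd := xd ltac:(by clear; lia).
      split=> //; last exact: connect_trans yd.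
      by rewrite (connect_trans by_) // (connect_trans yd) // symC.
    - have {}bx := bx ltac:(by clear; lia); have {}yd := yd ltac:(by clear; lia).
      have {}xd := xd ltac:(by clear; lia).
      split=> //; last exact: connect_trans xd.
      by rewrite (connect_trans bx) // (connect_trans xd) // symC.
    - have {}bx := bx ltac:(by clear; lia); have {}yd := yd ltac:(by clear; lia).
      have {}by_ := by_ ltac:(by clear; lia).
      by split=> //; apply: connect_trans yd.
    have {}bx := bx ltac:(by clear; lia); have {}by_ := by_ ltac:(by clear; lia).
    have {}xd := xd ltac:(by clear; lia).
    by split=> //; apply: connect_trans xd.
  have : [|| v == b :> nat, v == x :> nat, v == y :> nat | v == d :> nat].
    by rewrite eb ex ey ed; move: vi; move: (nat_of_ord v); clear; lia.
  by case/or4P=> /eqP/val_inj-> [] //.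
move=> v; have [l] := ubnP (nat_of_ord v); elim: l v => // l IH v.
have [v0 _|v_gt0] := posnP (nat_of_ord v).
  by have -> : v = ord0 by apply: val_inj.
move=> ltvl; have v_lt := ltn_ord v.
(* The predecessor is divided so that the first vertex of the block is strictly below [v] even when
   3 divides [v]. *)
have [||b eb bv] := block (v.-1 %/ 3) v; try by move: v_lt v_gt0; clear; lia.
by apply: connect_trans bv; apply: IH; rewrite eb; move: v_gt0 ltvl; clear; lia.
Qed.

Lemma chain_footprint : cactus_footprint chain.
Proof.
split.
- exact: chain_adj_sym.
- exact: chain_adj_irr.
- split=> [u v|c c' cc cc' ne].
    (* Any choice of edges serves here: with [set0] missing, the present graph is the footprint. *)
    have hp : in_blocks (fun i => (3 * i, 3 * i + 1)).
      by move=> i _; rewrite /in_block eqxx.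
    have := connected_one_per_block hp (sub0set _) u v.
    rewrite (eq_connect (e' := chain_adj)) // => a b.
    by rewrite /present /= in_set0 andbT.
  have [i [j [nij ci cj]]] := chain_cycles_apart cc cc' ne.
  apply/card_le1_eqP=> u v; rewrite !inE !ci !cj => hu hv.
  by apply: val_inj => /=; lia.
- exact: chain_port_numbering.
- exact: chain_ccw_ports.
Qed.
End Chain.

(** * Runs that look alike in a part of the graph *)

Section Agreement.
Variables (V : finType) (k m : nat) (K : knowledge) (A : algorithm).
Variables (G : port_graph V) (home0 : V).

(** Only [round] is run in a [world]; it ignores the schedule of the scenario. *)
Definition world b := Scenario G (fun=> set0) home0 b.
Definition step b M (C : configuration V m) := round k K A (world b) M C.
Definition loc (C : configuration V m) i := location (agent C i).

Lemma step_dead b M C i : loc C i = b -> agent (step b M C) i = agent C i.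
Proof. by move=> e; rewrite /= /next_agent /active /destroyed /= -/(loc C i) e eqxx. Qed.

Lemma step_move b M C i : loc (step b M C) i = loc C i \/
  present G M (loc C i) (loc (step b M C) i).
Proof.
rewrite /loc /= /next_agent; case: ifP => _; first by left.
case: (decided _) => [|p|q]; try by left.
rewrite /follow; case: pickP => [u /andP[u1 _]|_]; last by left.
by right.
Qed.

(** No agent that stays in [U] can tell the two configurations apart. *)
Definition agree (U : pred V) (C1 C2 : configuration V m) : Prop :=
  {in U, whiteboard C1 =1 whiteboard C2} /\
  (forall i, U (loc C1 i) || U (loc C2 i) -> agent C1 i = agent C2 i).

Section Step.
Variables (b1 b2 : V) (M1 M2 : {set {set V}}) (C1 C2 : configuration V m).
Variable U : pred V.
Hypothesis C12 : agree U C1 C2.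
Hypothesis alive : forall i, U (loc C1 i) -> (loc C1 i == b1) = (loc C1 i == b2).
Hypothesis M12 : forall v u, U v -> adj G v u ->
  ([set v; u] \in M1) = ([set v; u] \in M2).

(** Agents located in [U] in either configuration have the same state in both, so an agent in [U]
    has the same company; [M12] makes it see the same missing ports. *)
Lemma agree_view i w : U (loc C1 i) ->
  view_of k K (world b1) C1 M1 i w = view_of k K (world b2) C2 M2 i w.
Proof.
move=> Ui; have ei : agent C1 i = agent C2 i by apply: C12.2; rewrite Ui.
have locE j : (loc C1 j == loc C1 i) = (loc C2 j == loc C1 i).
  apply/eqP/eqP => e; have := C12.2 j; rewrite e Ui ?orbT => /(_ isT) ej.
    by rewrite -e /loc ej.
  by rewrite -e /loc ej.
rewrite /view_of -ei -/(loc C1 i); congr LocalView.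
- apply: eq_filter => p; apply: eq_existsb => u.
  by case vu: (adj _ _ _) => //=; rewrite M12.
- under eq_filter => j do rewrite -/(loc C1 j) locE.
  apply/eq_in_map => j; rewrite mem_filter => /andP[/andP[_ /eqP ej] _].
  by have -> : agent C1 j = agent C2 j by apply: C12.2; rewrite [loc C2 j]ej Ui orbT.
Qed.

Lemma agree_active i : U (loc C1 i) ->
  active (world b1) (agent C1 i) = active (world b2) (agent C2 i).
Proof.
move=> Ui; have ei : agent C1 i = agent C2 i by apply: C12.2; rewrite Ui.
by rewrite -ei /active /destroyed /= -/(loc C1 i) alive.
Qed.

(** Turn by turn: an agent in [U] writes the same in both runs, and any other agent writes outside
    [U]. *)
Lemma agree_boards s c1 c2 : {in U, c1 =1 c2} ->
  {in U, write_boards k K A (world b1) C1 M1 s c1 =1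
         write_boards k K A (world b2) C2 M2 s c2}.
Proof.
elim: s c1 c2 => //= i s IH c1 c2 c12; apply: IH => u Uu.
case U1: (U (loc C1 i)).
  have ei : agent C1 i = agent C2 i by apply: C12.2; rewrite U1.
  rewrite agree_active // -ei -/(loc C1 i); case: ifP => _; last exact: c12.
  by rewrite (c12 _ U1) agree_view //; case: ifP => // _; apply: c12.
have [U2|U2] := boolP (U (loc C2 i)).
  by move: (U2) U1; rewrite /loc -C12.2 ?U2 ?orbT // => ->.
rewrite -/(loc C1 i) -/(loc C2 i).
have n1 : u == loc C1 i = false by apply: contraFF U1 => /eqP<-.
have n2 : u == loc C2 i = false by apply: contraNF U2 => /eqP<-.
by do 2!case: (_ && _); rewrite ?n1 ?n2 c12.
Qed.

Lemma agree_next i : U (loc C1 i) ->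
  agent (step b1 M1 C1) i = agent (step b2 M2 C2) i.
Proof.
move=> Ui; have ei : agent C1 i = agent C2 i by apply: C12.2; rewrite Ui.
rewrite /= /next_agent agree_active // agree_view //.
have -> : board_at_turn k K A (world b1) C1 M1 i = board_at_turn k K A (world b2) C2 M2 i.
  by rewrite /board_at_turn -ei; apply: agree_boards => //; apply: C12.1.
rewrite -ei; case: ifP => // _.
case: (decided _) => // p; rewrite /follow -/(loc C1 i).
rewrite (eq_pick (Q := fun u => present G M2 (loc C1 i) u && (port G (loc C1 i) u == p))) //.
by move=> u /=; rewrite /present /=; case vu: (adj _ _ _) => //=; rewrite M12.
Qed.

(** Agreement may shrink to a smaller region, and is only lost if an agent from outside [U] brings
    news into [U']. *)
Lemma agree_step (U' : pred V) : subpred U' U ->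
    (forall i, ~~ U (loc C1 i) -> ~~ U' (loc (step b1 M1 C1) i)) ->
    (forall i, ~~ U (loc C2 i) -> ~~ U' (loc (step b2 M2 C2) i)) ->
  agree U' (step b1 M1 C1) (step b2 M2 C2).
Proof.
move=> sU out1 out2; split=> [v U'v|i].
  by apply: agree_boards => [u Uu|]; [apply: C12.1|apply: sU].
have [U1 _|nU1] := boolP (U (loc C1 i)); first exact: agree_next.
have [U2 _|nU2] := boolP (U (loc C2 i)).
  by move: (U2) nU1; rewrite /loc -C12.2 ?U2 ?orbT // => ->.
by rewrite (negbTE (out1 _ nU1)) (negbTE (out2 _ nU2)).
Qed.
End Step.

End Agreement.

(** * The adversary *)

Section Adversary.
Variables (n : nat) (K : knowledge) (A : algorithm).
Hypothesis n_gt0 : 0 < n.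

Local Notation config := (configuration (node n) n.+2).
Local Notation step := (@step (node n) n.+1 n.+2 K A (chain n) ord0).

Definition pos (C : config) i : nat := loc C i.

(** In every cycle but the last, the missing edge leads to the far end and is
    chosen so that the agents of the cycle cannot all leave it forwards. *)
Definition blockade (C : config) (d : nat * nat) i : nat * nat :=
  if i == n then d
  else if [exists j, pos C j == 3 * i + 1] then (3 * i + 1, 3 * i + 3)
  else (3 * i + 2, 3 * i + 3).

Definition strategy := nat -> config -> nat * nat.

Definition valid (e : strategy) := forall t C, in_block n (e t C).

Definition closed C d := one_per_block n (blockade C d).

(** The graph of index 0 is the footprint, so the adversary acts from index 1 on. *)
Definition schedule (e : strategy) t C := if t == 0 then set0 else closed C (e t C).

Fixpoint history b (e : strategy) t : config :=
  if t is t'.+1 then step b (schedule e t' (history b e t')) (history b e t')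
  else initial n.+2 (world (chain n) ord0 b).

(** The algorithm is deterministic, so an adversary reacting to configurations amounts to a schedule
    fixed in advance, read off the simulated run. *)
Definition hunt b e : scenario (node n) :=
  Scenario (chain n) (fun t => schedule e t (history b e t)) ord0 b.

Lemma run_hunt b e t : run n.+1 n.+2 K A (hunt b e) t = history b e t.
Proof. by elim: t => //= t ->. Qed.

Lemma in_blocks_blockade C d : in_block n d -> in_blocks n (blockade C d).
Proof.
move=> d_n i _; rewrite /blockade; case: eqP => [->|_] //.
by case: ifP => _; rewrite /in_block eqxx ?orbT.
Qed.

Lemma hunt_admissible b e : valid e -> b != ord0 -> admissible n.+1 n.+2 (hunt b e).
Proof.
move=> ve b0; split.
- exact: chain_footprint.
- split=> // r.
  suff [p p_in sub] : exists2 p, in_blocks n p & schedule e r (history b e r) \subset one_per_block n p.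
    split; first exact: subset_trans sub (one_per_block_edges p_in).
      exact: leq_trans (subset_leq_card sub) (card_one_per_block _ p).
    exact: connected_one_per_block sub.
  exists (blockade (history b e r) (e r (history b e r))).
    by apply: in_blocks_blockade; apply: ve.
  by rewrite /schedule; case: ifP => // _; apply: sub0set.
- by rewrite card_ord; lia.
- by apply/eqP; rewrite eq_sym.
Qed.

(** Some agent reports [b] correctly. Its state, hence its position and its route, also occurs alive
    in a run with black hole [b'], where the report must be correct too; but a route ends at one
    node only. *)
Lemma no_confusion b e : solves_BHS n.+1 n.+2 K A -> valid e -> b != ord0 ->
  (forall t i, loc (history b e t) i != b -> exists b' e',
     [/\ valid e', b' != ord0, b' != b, loc (history b e t) i != b'
       & agent (history b e t) i = agent (history b' e' t) i]) ->
  False.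
Proof.
move=> sol ve b0 conf.
have [[t [i [q [ends good]]]] _] := sol _ _ (hunt_admissible ve b0).
move: ends good; rewrite run_hunt => -[alive rep] good.
have [b' [e' [ve' b'0 b'b alive' same]]] := conf t i alive.
have [_ right_] := sol _ _ (hunt_admissible ve' b'0).
have := right_ t i q; rewrite run_hunt -same => /(_ (conj alive' rep)).
rewrite /correct_route /= in good *; rewrite good => -[ebb'].
by rewrite ebb' eqxx in b'b.
Qed.

Lemma agree_eq (C1 C2 : config) : agree predT C1 C2 -> C1 = C2.
Proof.
case: C1 C2 => [a1 w1] [a2 w2] [/= ew ea]; congr Configuration.
  by apply: functional_extensionality => i; apply: ea.
by apply: functional_extensionality => v; apply: ew.
Qed.

Lemma step_eq b1 b2 M C : (forall i, loc C i != b1) -> (forall i, loc C i != b2) ->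
  step b1 M C = step b2 M C.
Proof.
move=> n1 n2; apply: agree_eq; apply: (agree_step (U := predT)) => //.
by move=> i _; rewrite (negbTE (n1 i)) (negbTE (n2 i)).
Qed.

(** The place of the black hole has no effect until an agent stands on it. Watching the first run
    suffices, as the second equals it up to that point. *)
Lemma history_eq b1 b2 e1 e2 T :
    (forall t, t < T -> e1 t =1 e2 t) ->
    (forall t i, t < T -> loc (history b1 e1 t) i != b1) ->
    (forall t i, t < T -> loc (history b1 e1 t) i != b2) ->
  forall t, t <= T -> history b1 e1 t = history b2 e2 t.
Proof.
move=> e12 n1 n2; elim=> //= t IH ltT; rewrite -(IH (ltnW ltT)).
rewrite /schedule e12 //; apply: step_eq => i; [exact: n1|exact: n2].
Qed.

Lemma move_any b M C i : pos (step b M C) i = pos C i \/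
  chain_adj (loc C i) (loc (step b M C) i).
Proof.
have [|/andP[? _]] := step_move n.+1 K A (chain n) ord0 b M C i; last by right.
by rewrite /pos => ->; left.
Qed.

Lemma moves b M C i (q := pos C i) (q' := pos (step b M C) i) :
  [/\ q' <= q + 2, q <= q' + 2,
      forall j, q = 3 * j + 1 \/ q = 3 * j + 2 ->
        [\/ q' = q, q' = 3 * j | q' = 3 * j + 3],
      q = 3 * n + 3 -> [\/ q' = q, q' = 3 * n + 1 | q' = 3 * n + 2] &
      q < 3 * n -> q' <= 3 * n].
Proof.
have := move_any b M C i; rewrite -/q -/q' => -[->|uv].
  by split; try (by clear; lia); move=> *; apply: Or31.
have lt' : q' < (3 * n).+4 := ltn_ord _.
have near : ((3 %| q) != (3 %| q')) && (q - q' <= 2) && (q' - q <= 2) := uv.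
have hub : q = 3 * n + 3 -> _ := fun e => chain_adj_hub (i := n.+1) (etrans e _) uv.
have side j := fun e => chain_adj_side (u := loc C i) (i := j) e uv.
move: side hub; rewrite -![nat_of_ord (loc C i)]/q -![nat_of_ord _]/q' => side hub.
clearbody q q'; move: lt' near side hub; clear => lt' near side hub; split.
- by lia.
- by lia.
- by move=> j /side[] ?; [apply: Or32|apply: Or33].
- move=> /hub[||||] *; [lia|lia|lia|apply: Or33; lia|apply: Or32; lia].
- by move: near; clear; lia.
Qed.

Lemma blocked b C d i u v : in_block n d ->
    u < v -> blockade C d (u %/ 3) = (u, v) ->
  let C' := step b (closed C d) C in
  ~ (pos C i = u /\ pos C' i = v) /\ ~ (pos C i = v /\ pos C' i = u).
Proof.
move=> d_n ltuv def_uv C'.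
have p_in := in_blocks_blockade C d_n.
have := step_move n.+1 K A (chain n) ord0 b (closed C d) C i.
rewrite -/C' => mv; split=> -[eu ev].
  case: mv => [e|/andP[adj_ /negP[]]]; first by move: ltuv; rewrite -eu -ev /pos e ltnn.
  by rewrite mem_one_per_block // -!/(pos _ _) eu ev ?def_uv.
case: mv => [e|/andP[adj_ /negP[]]]; first by move: ltuv; rewrite -eu -ev /pos e ltnn.
rewrite setUC mem_one_per_block // -!/(pos _ _) ?eu ?ev ?def_uv //.
by rewrite chain_adj_sym.
Qed.

Lemma blocked_last b C u v i : in_block n (u, v) ->
  let C' := step b (closed C (u, v)) C in
  ~ (pos C i = u /\ pos C' i = v) /\ ~ (pos C i = v /\ pos C' i = u).
Proof.
move=> uv_n; apply: blocked => //.
  by move: uv_n; rewrite /in_block !xpair_eqE; clear; lia.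
rewrite /blockade ifT //.
by move: uv_n; rewrite /in_block !xpair_eqE; clear; lia.
Qed.

(** * Agents held back in the first [n] cycles *)

(** Destroyed agents count: they never move again. *)
Definition gated C := forall i, i <= n -> i <= #|[set j | pos C j < 3 * i]|.

(** If an agent is at 3i + 1, its way forward is closed, so it adds one to the i agents behind 3i,
    none of which can reach 3i + 3 in one move. Otherwise only agents at 3i + 2 could pass to 3i +
    3, and that edge is closed, so the i + 1 agents already behind stay there. *)
Lemma gated_step b C d : in_block n d -> gated C -> gated (step b (closed C d) C).
Proof.
move=> d_n gC [|i] //= ltin; set C' := step _ _ _.
have near j : pos C' j <= pos C j + 2 by have [] := moves b (closed C d) C j.
have [/existsP[a /eqP ea]|none] := boolP [exists j, pos C j == 3 * i + 1].
  have na : pos C' a < 3 * i.+1.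
    have [||nb _] := @blocked b C d a (3 * i + 1) (3 * i + 3) d_n.
    - by clear; lia.
    - have -> : (3 * i + 1) %/ 3 = i by clear; lia.
      rewrite /blockade ltn_eqF // ifT //; apply/existsP; exists a.
      exact/eqP.
    by have := near a; rewrite ea; move: nb; rewrite ea -/C'; clear; lia.
  apply: leq_trans (subset_leq_card (_ : a |: [set j | pos C j < 3 * i] \subset _)).
    by rewrite cardsU1 inE ea -leqNgt leq_addr /= add1n ltnS gC // ltnW.
  apply/subsetP=> j; rewrite !inE => /orP[/eqP->//|].
  by have := near j; clear; lia.
apply: leq_trans (gC _ ltin) (subset_leq_card _).
apply/subsetP=> j; rewrite !inE => lt_j.
have [||nb _] := @blocked b C d j (3 * i + 2) (3 * i + 3) d_n.
- by clear; lia.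
- have -> : (3 * i + 2) %/ 3 = i by clear; lia.
  by rewrite /blockade ltn_eqF // ifN.
have nj : pos C j != 3 * i + 1 by move: none; rewrite negb_exists => /forallP.
have [_ _ side _ _] := moves b (closed C d) C j.
have := near j; move: lt_j nj nb (side i); rewrite -/C'.
have [-> _ _ + /(_ (or_intror erefl))|] := eqVneq (pos C j) (3 * i + 2).
  by clear => ? []; lia.
by clear; lia.
Qed.

Lemma gated_history b e : valid e -> forall t, gated (history b e t).
Proof.
move=> ve; elim=> [|t IH].
  move=> [|i] ltin //; rewrite (_ : finset _ = setT) ?cardsT ?card_ord; first lia.
  by apply/setP=> j; rewrite !inE.
rewrite /= /schedule; case: eqP => [->|_]; last exact: gated_step.
(* All edges are present in round 0, but one move from 0 leads at most to 2, short of 3. *)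
move=> [|i] ltin //; rewrite (_ : finset _ = setT) ?cardsT ?card_ord; first lia.
apply/setP=> j; rewrite !inE.
have [+ _ _ _ _] := moves b set0 (history b e 0) j.
by rewrite {2}/pos /=; clear; lia.
Qed.

(** Of the n + 2 agents at least n are behind 3n, which leaves room for [a] and [c] only. *)
Lemma gated_two C a c : gated C -> a != c -> 3 * n <= pos C a -> 3 * n <= pos C c ->
  forall i, 3 * n <= pos C i -> i = a \/ i = c.
Proof.
move=> gC nac ha hc i hi.
have sub : [set j | pos C j < 3 * n] \subset ~: [set a; c].
  by apply/subsetP=> j; rewrite !inE negb_or => lt_j; apply/andP; split;
     apply: contraTneq lt_j => ->; rewrite -leqNgt.
have := cardsC [set a; c]; rewrite cards2 nac card_ord => card_ac.
have /eqP eqs : [set j | pos C j < 3 * n] == ~: [set a; c].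
  rewrite eqEcard sub /=; apply: leq_trans (gC n (leqnn n)).
  by move: card_ac; rewrite !addSn add0n => -[->].
have : i \notin [set j | pos C j < 3 * n] by rewrite inE -leqNgt.
by rewrite eqs !inE negbK => /orP[] /eqP; [left|right].
Qed.

(** * Runs that look alike before the last cycle *)

Lemma blockade_agree (C1 C2 : config) (U : pred (node n)) d1 d2 i :
  (forall v : node n, v < 3 * n -> U v) -> agree U C1 C2 -> i < n ->
  blockade C1 d1 i = blockade C2 d2 i.
Proof.
move=> sU [_ ca] ltin; rewrite /blockade !ltn_eqF //.
have -> // : [exists j, pos C1 j == 3 * i + 1] = [exists j, pos C2 j == 3 * i + 1].
apply: eq_existsb => j; apply/eqP/eqP => e.
  by rewrite -e /pos /loc -ca // sU // -[nat_of_ord _]/(pos C1 j) e; lia.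
by rewrite -e /pos /loc ca // orbC sU // -[nat_of_ord _]/(pos C2 j) e; lia.
Qed.

Lemma closed_same C1 C2 d1 d2 (v u : node n) : in_block n d1 -> in_block n d2 ->
    chain_adj v u ->
    blockade C1 d1 (minn v u %/ 3) = blockade C2 d2 (minn v u %/ 3) ->
  ([set v; u] \in closed C1 d1) = ([set v; u] \in closed C2 d2).
Proof.
move=> in1 in2 vu e12; have p1 := in_blocks_blockade C1 in1.
have p2 := in_blocks_blockade C2 in2.
have [lt|lt|/val_inj e] := ltngtP v u; last by move: vu; rewrite e chain_adj_irr.
  by rewrite !mem_one_per_block //; move: e12; rewrite (minn_idPl (ltnW lt)) => ->.
rewrite setUC !mem_one_per_block // 1?chain_adj_sym //.
by move: e12; rewrite (minn_idPr (ltnW lt)) => ->.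
Qed.

Definition below : pred (node n) := fun v => v < 3 * n.

(** Since [a] and [c] are the only agents at or past 3n and do not go back, nothing that differs
    between the runs is carried below 3n. *)
Lemma locked_step b1 b2 d1 d2 C1 C2 a c
    (C1' := step b1 (closed C1 d1) C1) (C2' := step b2 (closed C2 d2) C2) :
    in_block n d1 -> in_block n d2 -> gated C1 -> gated C2 -> a != c ->
    3 * n <= b1 -> 3 * n <= b2 ->
    (forall i, i = a \/ i = c -> [/\ 3 * n <= pos C1 i, 3 * n <= pos C2 i,
                                     3 * n <= pos C1' i & 3 * n <= pos C2' i]) ->
  agree below C1 C2 -> agree below C1' C2'.
Proof.
move=> in1 in2 g1 g2 nac hb1 hb2 hac C12.
have [a1 a2 _ _] := hac a (or_introl erefl).
have [c1 c2 _ _] := hac c (or_intror erefl).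
apply: (agree_step C12) => //.
- move=> i; rewrite /below => lt_i; rewrite -!(inj_eq val_inj) /=.
  by move: lt_i hb1 hb2; clear; lia.
- move=> v u lt_v vu; apply: closed_same => //.
  apply: (@blockade_agree _ _ below) => //.
  by move: lt_v; rewrite /below; clear; lia.
- move=> i; rewrite /below -leqNgt => hi; rewrite -leqNgt.
  by have [] := hac i (gated_two g1 nac a1 c1 hi).
- move=> i; rewrite /below -leqNgt => hi; rewrite -leqNgt.
  by have [] := hac i (gated_two g2 nac a2 c2 hi).
Qed.

Lemma historyS b e t : 0 < t -> history b e t.+1 =
  step b (closed (history b e t) (e t (history b e t))) (history b e t).
Proof. by case: t. Qed.

Lemma dead_stays (b : node n) M C i : pos C i = b -> pos (step b M C) i = b.
Proof. by move=> /val_inj e; rewrite /pos /loc step_dead -?/(loc C i) ?e. Qed.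

Lemma pos_neq C i (v : node n) : (loc C i != v) = (pos C i != v).
Proof. by rewrite -(inj_eq val_inj). Qed.

Lemma node_val a : a <= 3 * n + 3 -> (inord a : node n) = a :> nat.
Proof. by move=> lea; rewrite inordK //; move: lea; clear; lia. Qed.

(** * The first entry into the last cycle *)

Definition far : node n := inord (3 * n + 3).

(** The last cycle is 3n, 3n + 1, 3n + 3 = [far], 3n + 2.  While nobody is past 3n,
    [first_choice] leaves one way in, avoiding, if it can, that two agents take it
    together. *)
Definition crowded C := [exists i, exists j,
  [&& i != j, pos (step far (closed C (3 * n, 3 * n + 1)) C) i == 3 * n + 2
    & pos (step far (closed C (3 * n, 3 * n + 1)) C) j == 3 * n + 2]].

Definition first_choice C :=
  if crowded C then (3 * n, 3 * n + 2) else (3 * n, 3 * n + 1).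

Definition start : strategy := fun=> first_choice.

Lemma first_choice_block C : in_block n (first_choice C).
Proof. by rewrite /first_choice; case: ifP => _; rewrite /in_block eqxx ?orbT. Qed.

Lemma valid_start : valid start.
Proof. by move=> t C; apply: first_choice_block. Qed.

Hypothesis sol : solves_BHS n.+1 n.+2 K A.

(** Otherwise the runs with black hole [far] and with black hole 3n + 1 coincide forever, since
    neither node is ever visited. *)
Lemma someone_enters : ~ (forall t i, pos (history far start t) i <= 3 * n).
Proof.
move=> low; have farE : far = 3 * n + 3 :> nat by apply: node_val.
pose x : node n := inord (3 * n + 1).
have xE : x = 3 * n + 1 :> nat by apply: node_val; clear; lia.
apply: (no_confusion (b := far) sol valid_start) => [|t i _].
  by rewrite -(inj_eq val_inj) /= farE; clear; lia.
have neq v t' j : 3 * n < nat_of_ord v -> loc (history far start t') j != v.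
  by move=> hv; rewrite pos_neq; have := low t' j; move: hv; clear; lia.
exists x, start; split.
- exact: valid_start.
- by rewrite -(inj_eq val_inj) /= xE; clear; lia.
- by rewrite -(inj_eq val_inj) /= xE farE; clear; lia.
- by apply: neq; rewrite xE; clear; lia.
rewrite -(@history_eq far x start start t) // => t' j _; apply: neq.
  by rewrite farE; clear; lia.
by rewrite xE; clear; lia.
Qed.

Section Entry.
Variable T : nat.
Hypothesis T_gt0 : 0 < T.
Hypothesis low : forall t i, t <= T -> pos (history far start t) i <= 3 * n.

Let C := history far start T.

Definition after N (f : config -> nat * nat) : strategy :=
  fun t => if t < N then first_choice else f.

(** [N] may be [T.+1]: the configuration reached then results from rounds that start with nobody
    past 3n. *)
Lemma after_early b f N t : 3 * n < nat_of_ord b -> t <= N <= T.+1 ->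
  history b (after N f) t = history far start t.
Proof.
have farE : far = 3 * n + 3 :> nat by apply: node_val.
move=> hb /andP[le_t leN]; apply/esym.
have neq v t' j : t' < N -> 3 * n < nat_of_ord v -> loc (history far start t') j != v.
  by move=> ltT hv; rewrite pos_neq; have := low j (leq_trans ltT leN); move: hv; clear; lia.
apply: (@history_eq far b start (after N f) N) => // [t' ltT D|t' j ltT|t' j ltT].
- by rewrite /after ltT.
- by apply: neq => //; rewrite farE; clear; lia.
- exact: neq.
Qed.

(** If two agents enter together whichever way is open, both die with the black
    hole placed there, and the agents left behind 3n are stuck in the dark. *)
Lemma no_double_entry c d c' d' : c != d -> c' != d' ->
  pos (step far (closed C (3 * n, 3 * n + 1)) C) c = 3 * n + 2 ->
  pos (step far (closed C (3 * n, 3 * n + 1)) C) d = 3 * n + 2 ->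
  pos (step far (closed C (3 * n, 3 * n + 2)) C) c' = 3 * n + 1 ->
  pos (step far (closed C (3 * n, 3 * n + 2)) C) d' = 3 * n + 1 -> False.
Proof.
move=> ncd ncd' ec ed ec' ed'.
have farE : far = 3 * n + 3 :> nat by apply: node_val.
pose x : node n := inord (3 * n + 1); pose y : node n := inord (3 * n + 2).
have xE : x = 3 * n + 1 :> nat by apply: node_val; clear; lia.
have yE : y = 3 * n + 2 :> nat by apply: node_val; clear; lia.
(* [f 1] sends the pair to 3n + 2 and [f 2] sends it to 3n + 1; each is combined with the black hole
   at that destination. *)
pose f a : config -> nat * nat := fun=> (3 * n, 3 * n + a).
have f_n a D : 0 < a < 3 -> in_block n (f a D).
  by rewrite /f /in_block !xpair_eqE; clear; lia.
have vf a : 0 < a < 3 -> valid (after T (f a)).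
  by move=> lea t D; rewrite /after; case: ifP => _; [apply: first_choice_block|apply: f_n].
have lowC i : pos C i <= 3 * n by apply: low.
have gC : gated C by apply/gated_history/valid_start.
have stepE b M : 3 * n < nat_of_ord b -> step b M C = step far M C.
  move=> hb; apply: step_eq => i; rewrite pos_neq; have := lowC i; rewrite ?farE;
  by move: hb; clear; lia.
have at_h M i : 3 * n < pos (step far M C) i -> pos C i = 3 * n.
  have [_ _ _ _ lt_] := moves far M C i => lt'; have := lowC i.
  by move: lt_ lt'; clear; lia.
have hc : pos C c = 3 * n by apply: (at_h (closed C (3 * n, 3 * n + 1))); rewrite ec; clear; lia.
have hd : pos C d = 3 * n by apply: (at_h (closed C (3 * n, 3 * n + 1))); rewrite ed; clear; lia.
(* Only two agents can be at 3n, so [c'] and [d'] are [c] and [d] in some order. *)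
have [ecx edx] : pos (step far (closed C (3 * n, 3 * n + 2)) C) c = 3 * n + 1 /\
                 pos (step far (closed C (3 * n, 3 * n + 2)) C) d = 3 * n + 1.
  have hc' : pos C c' = 3 * n by apply: (at_h (closed C (3 * n, 3 * n + 2))); rewrite ec'; clear; lia.
  have hd' : pos C d' = 3 * n by apply: (at_h (closed C (3 * n, 3 * n + 2))); rewrite ed'; clear; lia.
  have two i : pos C i = 3 * n -> i = c \/ i = d.
    by move=> hi; apply: (gated_two gC ncd); rewrite ?hi ?hc ?hd.
  by move: ncd' ec' ed'; case: (two _ hc') (two _ hd') => -> [] ->; rewrite ?eqxx.
pose HY := history y (after T (f 1)); pose HX := history x (after T (f 2)).
have inv t : T < t -> [/\ agree below (HY t) (HX t),
    pos (HY t) c = y /\ pos (HY t) d = y & pos (HX t) c = x /\ pos (HX t) d = x].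
  elim: t => // t IH; rewrite ltnS leq_eqVlt => /orP[/eqP<-|ltTt].
    rewrite /HY /HX !historyS // !after_early ?xE ?yE; try by clear; lia.
    rewrite -/C /after ltnn /f !stepE ?xE ?yE; try by clear; lia.
    split; [|by rewrite ec ed|by rewrite ecx edx].
    apply: (locked_step (a := c) (c := d)) => //.
    - exact: (f_n 1 C).
    - exact: (f_n 2 C).
    - by rewrite farE; clear; lia.
    - by rewrite farE; clear; lia.
    by move=> i [] ->; rewrite ?ec ?ed ?ecx ?edx ?hc ?hd; clear; split; lia.
  have [ag [yc yd] [xc xd]] := IH ltTt.
  have t_gt0 : 0 < t by apply: ltn_trans ltTt.
  rewrite /HY /HX !historyS // -/(HY t) -/(HX t).
  rewrite !dead_stays //; split=> //.
  apply: (locked_step (a := c) (c := d)) => //.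
  - by apply: vf.
  - by apply: vf.
  - by apply/gated_history/vf.
  - by apply/gated_history/vf.
  - by rewrite yE; clear; lia.
  - by rewrite xE; clear; lia.
  - by move=> i [] ->; rewrite !dead_stays // ?yc ?yd ?xc ?xd xE yE; clear; split; lia.
apply: (no_confusion (b := y) (e := after T (f 1)) sol) => [||t i alive].
- exact: vf.
- by rewrite -(inj_eq val_inj) /= yE; clear; lia.
exists x, (after T (f 2)); split.
- exact: vf.
- by rewrite -(inj_eq val_inj) /= xE; clear; lia.
- by rewrite -(inj_eq val_inj) /= xE yE; clear; lia.
all: have [le_t|lt_t] := leqP t T.
- rewrite after_early ?yE ?le_t ?leqnSn //; last by clear; lia.
  by rewrite pos_neq; have := low i le_t; rewrite xE; clear; lia.
- have [ag [yc yd] [xc xd]] := inv t lt_t.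
  rewrite pos_neq; apply: contraTneq alive => e.
  have : i = c \/ i = d.
    apply: (@gated_two (HY t)) => //; rewrite ?yc ?yd ?[pos _ _]e ?xE ?yE; try by clear; lia.
    exact/gated_history/vf.
  by case=> ->; rewrite pos_neq negbK; apply/eqP.
- by rewrite !after_early ?xE ?yE ?le_t ?leqnSn //; clear; lia.
- have [ag [yc yd] [xc xd]] := inv t lt_t.
  apply: ag.2; rewrite /below -!/(pos _ _).
  have [//|hi] := ltnP (pos (HY t) i) (3 * n).
  have : i = c \/ i = d.
    apply: (@gated_two (HY t)) => //; rewrite ?yc ?yd ?yE; try by clear; lia.
    exact/gated_history/vf.
  by move: alive; rewrite pos_neq => /eqP ne [] e; case: ne; rewrite e.
Qed.

Section Sides.
Variables s o : nat.
Hypothesis so : s = 3 * n + 1 /\ o = 3 * n + 2 \/ s = 3 * n + 2 /\ o = 3 * n + 1.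

Lemma blocks_so : [/\ in_block n (3 * n, s), in_block n (3 * n, o)
  & in_block n (o, 3 * n + 3)].
Proof. by rewrite /in_block !xpair_eqE; move: so; clear; split; lia. Qed.

(** With the edge between 3n and [s] missing, the last cycle becomes the path 3n, [o], 3n + 3,
    [s]. *)
Lemma moves_guarded b D i
    (q := pos D i) (q' := pos (step b (closed D (3 * n, s)) D) i) :
  [/\ q = s -> q' = s \/ q' = 3 * n + 3,
      q' = s -> q = s \/ q = 3 * n + 3,
      q <= 3 * n -> q' <= 3 * n \/ q' = o &
      q = o -> [\/ q' <= 3 * n, q' = o | q' = 3 * n + 3]].
Proof.
have [b1 _ _] := blocks_so.
have [nb1 nb2] := blocked_last b D i b1; rewrite -/q -/q' in nb1 nb2.
have := moves b (closed D (3 * n, s)) D i.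
rewrite -/q -/q' => -[up down side top low'].
have := side n; have lt_q : q < (3 * n).+4 := ltn_ord _.
clearbody q q'; move: lt_q up down top low' nb1 nb2 so; clear.
move=> lt_q up down top low' nb1 nb2 so side; split.
- move=> eq; have [|||] := side; first by lia.
  + by left; rewrite -eq.
  + by move=> e; case: nb2.
  + by right.
- move=> eq'; have [lt|ge] := ltnP q (3 * n); first by have := low' lt; lia.
  have [e|ne] := eqVneq q o; last by lia.
  by case: side => [|||]; move: so eq' e; clear; lia.
- by move=> le_q; have [/low'|] := ltnP q (3 * n); lia.
- move=> eq; have [|||] := side; first by lia.
  + by move=> ->; apply: Or32.
  + by move=> ->; apply: Or31.
  + by move=> ->; apply: Or33.
Qed.

(** The black hole is [far].  To [a], alone at [s], it might be [o]; to the others,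
    it might be [s].  If one of them dies at [far], it is kept in [s], [far] in the
    scenario with black hole [s], so that its survival goes unnoticed. *)
Lemma no_single_entry a : first_choice C = (3 * n, o) ->
  pos (step far (closed C (3 * n, o)) C) a = s ->
  (forall j, j != a -> pos (step far (closed C (3 * n, o)) C) j <= 3 * n) ->
  False.
Proof.
move=> choice ea lowD.
have [b1 b2 b3] := blocks_so.
have farE : far = 3 * n + 3 :> nat by apply: node_val.
pose vs : node n := inord s; pose vo : node n := inord o.
have sE : vs = s :> nat by apply: node_val; move: so; clear; lia.
have oE : vo = o :> nat by apply: node_val; move: so; clear; lia.
pose fZ : config -> nat * nat := fun=> (3 * n, s).
pose fS : config -> nat * nat := fun D =>
  if [exists j, pos D j == 3 * n + 3] then (o, 3 * n + 3) else (3 * n, s).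
have fS_n D : in_block n (fS D) by rewrite /fS; case: ifP.
have vZ : valid (after T.+1 fZ).
  by move=> t D; rewrite /after; case: ifP => _; [apply: first_choice_block|].
have vS : valid (after T.+1 fS).
  by move=> t D; rewrite /after; case: ifP => _; [apply: first_choice_block|].
pose HZ := history far (after T.+1 fZ); pose HS := history vs (after T.+1 fS).
pose HO := history vo (after T.+1 fZ).
have gZ t : gated (HZ t) by apply/gated_history/vZ.
have gS t : gated (HS t) by apply/gated_history/vS.
have [lt_s lt_o] : 3 * n < s /\ 3 * n < o by move: so; clear; lia.
have early t : t <= T.+1 -> HZ t = history far start t /\
    HS t = history far start t /\ HO t = history far start t.
  by move=> le_t; rewrite /HZ /HS /HO !after_early ?le_t ?farE ?sE ?oE //=; clear; lia.
have D_E : history far start T.+1 = step far (closed C (3 * n, o)) C.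
  by rewrite historyS // -/C /start choice.
have HZS t : T < t -> HZ t.+1 = step far (closed (HZ t) (3 * n, s)) (HZ t).
  by move=> lt; rewrite /HZ historyS ?(ltn_trans _ lt) // /after ltnNge lt.
have HOS t : T < t -> HO t.+1 = step vo (closed (HO t) (3 * n, s)) (HO t).
  by move=> lt; rewrite /HO historyS ?(ltn_trans _ lt) // /after ltnNge lt.
have HSS t : T < t -> HS t.+1 = step vs (closed (HS t) (fS (HS t))) (HS t).
  by move=> lt; rewrite /HS historyS ?(ltn_trans _ lt) // /after ltnNge lt.
(* [HZ] against [HO], on the single node [s]: to join [a] there, another agent would have to cross
   3n + 3 in [HZ] or [o] in [HO], and it dies on the way. *)
have invO t : T < t -> [/\ forall j, j != a -> pos (HZ t) j <> s,
    pos (HZ t) a = s \/ pos (HZ t) a = 3 * n + 3 &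
    pos (HZ t) a = s -> agree (pred1 vs) (HZ t) (HO t) /\
      forall j, j != a -> pos (HO t) j <> s /\ pos (HO t) j <> 3 * n + 3].
  elim: t => // t IH; rewrite ltnS leq_eqVlt => /orP[/eqP<-|ltTt].
    have [-> [_ ->]] := early T.+1 (leqnn _); rewrite D_E ea.
    split; [|by left|].
      by move=> j /lowD; move: lt_s; clear; lia.
    by split=> // j /lowD; move: lt_s; clear; lia.
  have [nZ aZ aO] := IH ltTt; rewrite HZS // HOS //.
  have farZ i : pos (HZ t) i = 3 * n + 3 ->
      pos (step far (closed (HZ t) (3 * n, s)) (HZ t)) i = 3 * n + 3.
    by rewrite -farE; apply: dead_stays.
  have nZ' j : j != a -> pos (step far (closed (HZ t) (3 * n, s)) (HZ t)) j <> s.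
    move=> ja e'; have [_ to_s _ _] := moves_guarded far (HZ t) j.
    by case: (to_s e') => [/(nZ j ja)//|/farZ]; rewrite e'; move: so; clear; lia.
  split=> //.
    have [from_s _ _ _] := moves_guarded far (HZ t) a.
    by case: aZ => [/from_s//|/farZ]; right.
  move=> ea'; have eat : pos (HZ t) a = s.
    by case: aZ => // /farZ; rewrite ea'; move: so; clear; lia.
  have [ag nO] := aO eat; split.
    apply: (agree_step ag) => //.
    - move=> i /eqP ->; rewrite -!(inj_eq val_inj) /= sE oE farE.
      by move: so; clear; lia.
    - move=> v u /eqP -> su; apply: closed_same => //.
      have -> : minn vs u %/ 3 = n by move: (su : chain_adj vs u) so; rewrite /chain_adj sE; clear; lia.
      by rewrite /blockade eqxx.
    - move=> i /= ni; rewrite pos_neq sE; apply/eqP/nZ'.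
      by apply: contraNneq ni => ->; rewrite -(inj_eq val_inj) /= sE; apply/eqP.
    - move=> i /= ni; rewrite pos_neq sE.
      have ia : i != a.
        apply: contraNneq ni => ->; have vsa : loc (HZ t) a = vs.
          by apply: val_inj; rewrite /= sE.
        by rewrite /loc -ag.2 ?vsa /= -?/(loc _ _) ?vsa eqxx.
      have [_ to_s _ _] := moves_guarded vo (HO t) i.
      by have [n1 n2] := nO i ia; apply/eqP=> /to_s[].
  move=> j ja; have [n1 n2] := nO j ja.
  have [_ to_s low_ from_o] := moves_guarded vo (HO t) j.
  split; first by move/to_s; case.
  have [eo|neo] := eqVneq (pos (HO t) j) o.
    by rewrite dead_stays oE //; move: so; clear; lia.
  have lt' : pos (HO t) j < (3 * n).+4 := ltn_ord _.
  have le_ : pos (HO t) j <= 3 * n by move: n1 n2 neo lt' so; clear; lia.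
  by case: (low_ le_) => [|->]; move: so; clear; lia.
pose U : pred (node n) := fun v => (v <= 3 * n) || (v == o :> nat).
(* [HZ] against [HS], where [a] is dead at [s]: the runs agree on [U] until another agent [c] steps
   on 3n + 3. From then on they agree below 3n, with [a] and [c] both locked beyond. *)
have invS t : T < t -> pos (HS t) a = s /\
   (agree U (HZ t) (HS t) /\ (forall j, j != a -> U (loc (HZ t) j)) \/
    agree below (HZ t) (HS t) /\ exists c, [/\ c != a, pos (HZ t) c = 3 * n + 3
      & pos (HS t) c = s \/ pos (HS t) c = 3 * n + 3]).
  elim: t => // t IH; rewrite ltnS leq_eqVlt => /orP[/eqP<-|ltTt].
    have [-> [-> _]] := early T.+1 (leqnn _); rewrite D_E ea; split=> //.
    by left; split=> // j /lowD; rewrite /U -/(pos _ _) => ->.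
  have [_ aZ' _] := invO t.+1 (leqW ltTt); rewrite HZS // in aZ'.
  have [_ aZ _] := invO t ltTt.
  have [aS inv] := IH ltTt; rewrite HZS // HSS //.
  have aS' : pos (step vs (closed (HS t) (fS (HS t))) (HS t)) a = s.
    by apply: (etrans _ sE); apply: dead_stays; rewrite sE.
  split=> //.
  case: inv => [[ag inU]|[ag [c [nca cZ cS]]]]; last first.
    have cZ' : pos (step far (closed (HZ t) (3 * n, s)) (HZ t)) c = 3 * n + 3.
      by rewrite -farE; apply: dead_stays; rewrite farE.
    have cS' : pos (step vs (closed (HS t) (fS (HS t))) (HS t)) c = s \/
               pos (step vs (closed (HS t) (fS (HS t))) (HS t)) c = 3 * n + 3.
      case: cS => cS; first by left; apply: (etrans _ sE); apply: dead_stays; rewrite sE.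
      (* With the edge to [o] closed, [c] can only wait at 3n + 3 or die at [s]. *)
      have -> : fS (HS t) = (o, 3 * n + 3).
        by rewrite /fS ifT //; apply/existsP; exists c; apply/eqP.
      have [_ nb] := blocked_last vs (HS t) c b3.
      have [_ _ _ top _] := moves vs (closed (HS t) (o, 3 * n + 3)) (HS t) c.
      have {}nb : pos (step vs (closed (HS t) (o, 3 * n + 3)) (HS t)) c <> o.
        by move=> ?; apply: nb.
      case: (top cS); rewrite ?cS; move: nb so; clear; lia.
    right; split; last by exists c.
    apply: (locked_step (a := c) (c := a)) => //.
    - by rewrite farE; clear; lia.
    - by rewrite sE; apply: ltnW.
    move=> i [] ->; rewrite ?cZ ?cZ' ?aS ?aS'.
      by move: cS cS' lt_s; clear; split; lia.
    by move: aZ aZ' lt_s; clear; split; lia.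
  have inS j : j != a -> loc (HS t) j = loc (HZ t) j.
    by move=> ja; rewrite /loc ag.2 // inU.
  (* While nobody is at 3n + 3, [fS] closes the same edge as [fZ]. *)
  have no_far : fS (HS t) = (3 * n, s).
    rewrite /fS ifN //; apply/existsP=> -[j /eqP ej].
    have [eja|nja] := eqVneq j a; first by move: ej; rewrite eja aS; move: so; clear; lia.
    have := inU j nja; rewrite -inS // /U -/(pos _ _) ej.
    by move: so; clear; lia.
  rewrite no_far in aS' *.
  have alive i : U (loc (HZ t) i) -> (loc (HZ t) i == far) = (loc (HZ t) i == vs).
    rewrite /U -!(inj_eq val_inj) /= sE farE.
    by move: (nat_of_ord (loc (HZ t) i)) so; clear; lia.
  have same (v u : node n) : U v -> adj (chain n) v u ->
      ([set v; u] \in closed (HZ t) (3 * n, s)) = ([set v; u] \in closed (HS t) (3 * n, s)).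
    move=> Uv vu; apply: closed_same => //.
    have [lt|ge] := ltnP (minn v u %/ 3) n.
      by apply: blockade_agree ag lt => w lt_w; rewrite /U (ltnW lt_w).
    have -> : minn v u %/ 3 = n by move: ge Uv so; rewrite /U; clear; lia.
    by rewrite /blockade eqxx.
  have outZ i : ~~ U (loc (HZ t) i) -> i = a.
    by move=> ni; apply/eqP; apply: contraR ni => /inU.
  have outS i : ~~ U (loc (HS t) i) -> i = a.
    by move=> ni; apply/eqP; apply: contraR ni => ia; rewrite inS // inU.
  have below_U (v : node n) : below v -> U v by rewrite /below /U => /ltnW->.
  have not_U v : v = s \/ v = 3 * n + 3 -> ~~ ((v <= 3 * n) || (v == o)).
    by move: so; clear; lia.
  have [/existsP[c /andP[nca /eqP cZ']]|none] := boolP [exists j,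
     (j != a) && (pos (step far (closed (HZ t) (3 * n, s)) (HZ t)) j == 3 * n + 3)].
    right; split.
      apply: (agree_step ag alive same below_U) => i.
        by move/outZ=> ->; apply: contra (not_U _ aZ') => /below_U.
      by move/outS=> ->; apply: contra (not_U _ (or_introl aS')) => /below_U.
    (* The step of [c] is the same in both runs, so it is at 3n + 3 in [HS] too. *)
    exists c; split=> //; right; rewrite -cZ' /pos /loc.
    by rewrite -(agree_next n.+1 K A ord0 ag alive same (inU c nca)).
  left; split.
    apply: (agree_step ag alive same) => // i.
      by move/outZ=> ->; apply: not_U aZ'.
    by move/outS=> ->; apply: not_U (or_introl aS').
  move=> j ja; have := inU j ja; rewrite /U -!/(pos _ _).
  have := none; rewrite negb_exists => /forallP/(_ j); rewrite ja /=.
  have [_ _ low_ from_o] := moves_guarded far (HZ t) j.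
  move=> nfar /orP[/low_[->//|->]|/eqP/from_o[->//|->|e]]; rewrite ?eqxx ?orbT //.
  by rewrite e eqxx in nfar.
apply: (no_confusion (b := far) sol vZ) => [|t i alive].
  by rewrite -(inj_eq val_inj) /= farE; clear; lia.
have neq0 v : 3 * n < nat_of_ord v -> v != ord0 :> node n.
  by rewrite -(inj_eq val_inj) /=; clear; lia.
have vs_far : vs != far by rewrite -(inj_eq val_inj) /= sE farE; move: so; clear; lia.
have vo_far : vo != far by rewrite -(inj_eq val_inj) /= oE farE; move: so; clear; lia.
have [le_t|lt_t] := leqP t T.
  exists vo, (after T.+1 fZ); split; rewrite ?neq0 ?oE //.
    have [eZ _] := early t (leqW le_t).
    rewrite pos_neq -/(HZ t) eZ oE; have := low i le_t.
    by move: lt_o; clear; lia.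
  by rewrite -/(HZ t) -/(HO t); have [-> [_ ->]] := early t (leqW le_t).
have [nZ aZ aO] := invO t lt_t; have [aS inv] := invS t lt_t.
rewrite pos_neq farE -/(HZ t) in alive.
(* A report by [a] is refuted by black hole [o], one by any other agent by black hole [s]. *)
have [eia|nia] := eqVneq i a.
  rewrite eia in alive *; have eat : pos (HZ t) a = s.
    by case: aZ => // e; rewrite e eqxx in alive.
  exists vo, (after T.+1 fZ); split; rewrite ?neq0 ?oE //.
    by rewrite pos_neq -/(HZ t) eat oE; move: so; clear; lia.
  have [ag _] := aO eat; apply: ag.2; apply/orP; left => /=.
  by rewrite -(inj_eq val_inj) /= sE; apply/eqP.
exists vs, (after T.+1 fS); split; rewrite ?neq0 ?sE //.
  by rewrite pos_neq -/(HZ t) sE; apply/eqP/nZ.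
case: inv => [[ag inU]|[ag [c [nca cZ cS]]]]; apply: ag.2; apply/orP; left.
  exact: inU.
rewrite /below -/(pos _ _) ltnNge; apply: contra alive => ge_i.
have : i = a \/ i = c.
  apply: (@gated_two (HZ t)) => //; rewrite 1?eq_sym // ?cZ; last by clear; lia.
  by move: aZ lt_s; clear; lia.
by case=> e; [rewrite e eqxx in nia|rewrite e cZ].
Qed.
End Sides.
End Entry.

(** At the first entry all entrants come from 3n to the one open neighbour [s]. One entrant is
    excluded by [no_single_entry]. With several, [first_choice] was forced: pairs enter whichever
    way is open, which [no_double_entry] excludes. *)
Lemma no_entry t i : pos (history far start t) i <= 3 * n.
Proof.
suff low T : forall t i, t <= T -> pos (history far start t) i <= 3 * n.
  exact: (low t).
elim: T => [|T IH] {}t {}i; first by rewrite leqn0 => /eqP->.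
rewrite leq_eqVlt ltnS => /orP[/eqP->|]; last exact: IH.
have [T0|T_gt0] := posnP T.
  (* Round 0 is unguarded, but it leads at most to 2, and 2 < 3n since n > 0. *)
  have [up _ _ _ _] := moves far (schedule start T (history far start T)) (history far start T) i.
  by move: up; rewrite T0 /= {2}/pos /=; move: n_gt0; clear; lia.
have farE : far = 3 * n + 3 :> nat by apply: node_val.
rewrite leqNgt; apply/negP => lt_i; set C := history far start T.
have [s [o [so choice]]] : exists s o, (s = 3 * n + 1 /\ o = 3 * n + 2 \/
    s = 3 * n + 2 /\ o = 3 * n + 1) /\ first_choice C = (3 * n, o).
  rewrite /first_choice; case: ifP => _.
    by exists (3 * n + 1), (3 * n + 2); split; first left.
  by exists (3 * n + 2), (3 * n + 1); split; first right.
have [_ o_n _] := blocks_so so.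
have D_E : history far start T.+1 = step far (closed C (3 * n, o)) C.
  by rewrite historyS // -/C /start choice.
have entrant j : 3 * n < pos (history far start T.+1) j ->
    pos (history far start T.+1) j = s.
  rewrite D_E; have [nb _] := blocked_last far C j o_n.
  have [up _ _ _ low'] := moves far (closed C (3 * n, o)) C j.
  have := IH T j (leqnn T); rewrite -/C => le_j lt_j.
  have eh : pos C j = 3 * n by move: le_j lt_j low'; clear; lia.
  have no : pos (step far (closed C (3 * n, o)) C) j <> o by move=> ?; apply: nb.
  by move: up lt_j no so; rewrite eh; clear; lia.
have ei := entrant i lt_i.
have [/existsP[j /andP[ji lt_j]]|alone] := boolP [exists j,
    (j != i) && (3 * n < pos (history far start T.+1) j)]; last first.
  apply: (@no_single_entry T T_gt0 IH s o so i choice); rewrite -D_E // => j ji.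
  by have := alone; rewrite negb_exists => /forallP/(_ j); rewrite ji /= -leqNgt.
have ej := entrant j lt_j.
move: choice D_E; rewrite /first_choice; case: ifP => [crowd|no_crowd] [eo] D_E.
  case/existsP: crowd => c /existsP[d /and3P[ncd /eqP ec /eqP ed]].
  apply: (@no_double_entry T T_gt0 IH c d j i) => //; rewrite -/C eo -D_E ?ei ?ej;
  by move: so eo; clear; lia.
move: no_crowd; rewrite /crowded => /negbT/negP[].
apply/existsP; exists j; apply/existsP; exists i.
rewrite ji eo -D_E ei ej; move: so eo; clear; lia.
Qed.

End Adversary.

Theorem theorem5 (k : nat) (know_n know_k whiteboards : bool) (A : algorithm) :
  1 < k ->
  space_bounded k k.+1 (Knowledge know_n know_k whiteboards) A ->
  ~ solves_BHS k k.+1 (Knowledge know_n know_k whiteboards) A.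
Proof.
case: k => [|n] // n_gt0 _ sol.
exact: someone_enters sol (no_entry n_gt0 sol).
Qed.
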